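(* The operator $\Box^\bullet$ satisfies Löb's logic $\mathsf{GL}$ over $\mathsf{CHL}$: for all cyclic formulas $\phi,\psi$, (L1) if $\mathsf{CHL}\vdash\phi$ then $\mathsf{CHL}\vdash\Box^\bullet\phi$; (L2) $\mathsf{CHL}\vdash\Box^\bullet(\phi\to\psi)\to(\Box^\bullet\phi\to\Box^\bullet\psi)$; (L3) $\mathsf{CHL}\vdash\Box^\bullet\phi\to\Box^\bullet\Box^\bullet\phi$; (L4) $\mathsf{CHL}\vdash\Box^\bullet(\Box^\bullet\phi\to\phi)\to\Box^\bullet\phi$.
   Context: Labels: $\bot,\top$ and propositional variables (arity 0), $\neg,\Box$ (arity 1), $\wedge,\vee,\to$ (arity 2). A graph is $\langle V,r,S,\lambda\rangle$ with $V$ finite, root $r$, labelling $\lambda$, $S:V\to V^{*}$ ordered successors (length = arity of label); every vertex reachable from $r$. A (cyclic) formula is a graph in which every cycle (closed path of pairwise distinct vertices along successors) contains a $\Box$-labelled vertex. Bisimulation: $aRa'$ implies equal labels and $i$-th successors related; $\simeq$ = bisimilarity relating roots. $\phi$ modalised in $p$: every path from root to a $p$-labelled vertex contains a $\Box$-labelled vertex; then $\digamma p.\phi$ identifies the root with all $p$-labelled vertices (keeping the root's label). $\mathsf{CHL}$: least set of cyclic formulas containing all substitution instances of propositional tautologies, all $\Box(\phi\to\psi)\to(\Box\phi\to\Box\psi)$, all $\phi\leftrightarrow\psi$ with $\phi\simeq\psi$, closed under modus ponens, necessitation and Löb's rule (from $\vdash\Box\phi\to\phi$ infer $\vdash\phi$).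 $\Box^\bullet\phi:=\digamma p.\Box(\phi\wedge p)$ with $p$ not occurring in $\phi$. *)

(* Defs.v *)
From HB Require Import structures.
From mathcomp Require Import all_boot.
Set Implicit Arguments.
Unset Strict Implicit.
Unset Printing Implicit Defensive.

Inductive label : Type :=
  | LBot | LTop | LVar of nat
  | LNeg | LBox
  | LAnd | LOr | LImp.

Definition label_eq_dec (x y : label) : {x = y} + {x <> y}.
Proof. by decide equality; apply: eq_comparable. Defined.

HB.instance Definition _ := hasDecEq.Build label (compareP label_eq_dec).

Definition arity (l : label) : nat :=
  match l with
  | LBot | LTop | LVar _ => 0
  | LNeg | LBox => 1
  | LAnd | LOr | LImp => 2
  end.

Record graph := Graph {
  vert : finType;
  groot : vert;
  succ : vert -> seq vert;
  lab : vert -> label;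
  size_succ : forall v, size (succ v) = arity (lab v);
  reach_root : forall v, connect (fun x y => y \in succ x) groot v
}.

Definition edge (G : graph) : rel (vert G) := fun x y => y \in succ x.
Arguments edge : clear implicits.

Definition is_box (G : graph) (v : vert G) : bool := lab v == LBox.

(* Loops count as cycles: [cycle e [:: x]] is [e x x]. *)
Definition guarded (G : graph) : Prop :=
  forall c : seq (vert G),
    c != [::] -> cycle (edge G) c -> uniq c -> has (@is_box G) c.

Record cform := CForm { cgraph :> graph; cform_guarded : guarded cgraph }.

Definition bisimulation (G H : graph) (R : vert G -> vert H -> Prop) : Prop :=
  forall a b, R a b ->
    lab a = lab b /\
    forall i, i < arity (lab a) ->
      R (nth (groot G) (succ a) i) (nth (groot H) (succ b) i).

Definition bisimilar (G H : graph) : Prop :=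
  exists2 R : vert G -> vert H -> Prop,
    bisimulation R & R (groot G) (groot H).

Definition fresh (p : nat) (G : graph) : Prop :=
  forall v : vert G, lab v <> LVar p.

Lemma fresh_exists (G : graph) : exists p, fresh p G.
Proof.
pose f (v : vert G) := if lab v is LVar q then q else 0.
exists (\max_v f v).+1 => v lv.
by have := leq_bigmax (F := f) v; rewrite /f lv ltnn.
Qed.

(* A path from the root is a nonempty sequence [groot G :: s]; it includes both endpoints. *)
Definition modalised (p : nat) (G : graph) : Prop :=
  forall s : seq (vert G), path (edge G) (groot G) s ->
    lab (last (groot G) s) = LVar p -> has (@is_box G) (groot G :: s).

Section Leaf.
Variables (l : label) (arl : arity l = 0).

Definition leaf_succ (v : unit) : seq unit := [::].
Definition leaf_lab (v : unit) : label := l.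

Lemma leaf_size v : size (leaf_succ v) = arity (leaf_lab v).
Proof. by rewrite /leaf_lab arl. Qed.

Lemma leaf_reach v : connect (fun x y => y \in leaf_succ x) tt v.
Proof. by case: v; apply: connect0. Qed.

Definition leaf_graph : graph := Graph leaf_size leaf_reach.

Lemma leaf_guarded : guarded leaf_graph.
Proof. by case=> [|x [|y s]] //= _; rewrite /edge in_nil. Qed.

Definition leaf : cform := CForm leaf_guarded.
End Leaf.

Section Unary.
Variables (l : label) (arl : arity l = 1).

Section Graph.
Variable G : graph.

Definition unary_succ (v : option (vert G)) : seq (option (vert G)) :=
  if v is Some w then map Some (succ w) else [:: Some (groot G)].

Definition unary_lab (v : option (vert G)) : label :=
  if v is Some w then lab w else l.

Lemma unary_size v : size (unary_succ v) = arity (unary_lab v).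
Proof. by case: v => [w|] /=; rewrite ?size_map ?size_succ ?arl. Qed.

Lemma unary_reach v : connect (fun x y => y \in unary_succ x) None v.
Proof.
case: v => [w|]; last exact: connect0.
apply: (@connect_trans _ _ (Some (groot G))).
  by apply: connect1; rewrite /= inE.
have /connectP[s ps ->] := reach_root w.
elim: s (groot G) ps => [|y s IHs] x /=; first by move=> _; apply: connect0.
case/andP=> xy /IHs; apply: connect_trans; apply: connect1.
exact: map_f.
Qed.

Definition unary_graph : graph := Graph unary_size unary_reach.
End Graph.

Lemma unary_guarded (F : cform) : guarded (unary_graph F).
Proof.
move=> c c0 cyc_c uc.
have cS v : v \in c -> isSome v.
  move=> vc; have := prev_cycle cyc_c vc.
  case: v {vc} => //; case: (prev c _) => [w|]; rewrite /edge /=.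
    by case/mapP.
  by rewrite inE.
have [d dc] : exists d, c = map Some d.
  exists (pmap id c); elim: c cS {c0 cyc_c uc} => [|[v|] c IHc] cS //=.
    by rewrite -IHc // => w wc; apply: cS; rewrite inE wc orbT.
  by have := cS None (mem_head _ _).
subst c; rewrite has_map /=; apply: (@cform_guarded F).
- by case: d c0 {cyc_c uc cS}.
- rewrite -(@eq_cycle _ (relpre Some (edge (unary_graph F)))); last first.
    by move=> x y; rewrite /edge /= mem_map // => ? ? [].
  by move: cyc_c; rewrite cycle_map.
- by move: uc; rewrite map_inj_uniq // => ? ? [].
Qed.

Definition unary (F : cform) : cform := CForm (@unary_guarded F).
End Unary.

Section Binary.
Variables (l : label) (arl : arity l = 2).

Section Graph.
Variables G H : graph.

Definition binary_succ (v : option (vert G + vert H)) :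
    seq (option (vert G + vert H)) :=
  match v with
  | None => [:: Some (inl (groot G)); Some (inr (groot H))]
  | Some (inl w) => map (Some \o inl) (succ w)
  | Some (inr w) => map (Some \o inr) (succ w)
  end.

Definition binary_lab (v : option (vert G + vert H)) : label :=
  match v with
  | None => l
  | Some (inl w) => lab w
  | Some (inr w) => lab w
  end.

Lemma binary_size v : size (binary_succ v) = arity (binary_lab v).
Proof. by case: v => [[w|w]|] /=; rewrite ?size_map ?size_succ ?arl. Qed.

Lemma binary_reach v : connect (fun x y => y \in binary_succ x) None v.
Proof.
case: v => [[w|w]|]; last exact: connect0.
- apply: (@connect_trans _ _ (Some (inl (groot G)))).
    by apply: connect1; rewrite /= !inE eqxx.
  have /connectP[s ps ->] := reach_root w.
  elim: s (groot G) ps => [|y s IHs] x /=; first by move=> _; apply: connect0.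
  case/andP=> xy /IHs; apply: connect_trans; apply: connect1.
  exact: (map_f (Some \o inl)).
- apply: (@connect_trans _ _ (Some (inr (groot H)))).
    by apply: connect1; rewrite /= !inE eqxx orbT.
  have /connectP[s ps ->] := reach_root w.
  elim: s (groot H) ps => [|y s IHs] x /=; first by move=> _; apply: connect0.
  case/andP=> xy /IHs; apply: connect_trans; apply: connect1.
  exact: (map_f (Some \o inr)).
Qed.

Definition binary_graph : graph := Graph binary_size binary_reach.
End Graph.

Lemma binary_guarded (F F' : cform) : guarded (binary_graph F F').
Proof.
move=> c c0 cyc_c uc.
pose e := edge (binary_graph F F').
have pathl x s : path e (Some (inl x)) s ->
    exists t, s = map (Some \o inl) t.
  elim: s x => [|y s IHs] x /=; first by exists [::].
  case/andP=> /mapP[z _ ->] /IHs[t ->].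
  by exists (z :: t).
have pathr x s : path e (Some (inr x)) s ->
    exists t, s = map (Some \o inr) t.
  elim: s x => [|y s IHs] x /=; first by exists [::].
  case/andP=> /mapP[z _ ->] /IHs[t ->].
  by exists (z :: t).
have injl : injective (Some \o inl : vert F -> option (vert F + vert F')).
  by move=> ? ? [].
have injr : injective (Some \o inr : vert F' -> option (vert F + vert F')).
  by move=> ? ? [].
case: c c0 cyc_c uc => // -[[x|x]|] s _ cyc_c uc.
- have [t st] : exists t, s = map (Some \o inl) t.
    by apply: (pathl x); move: cyc_c; rewrite /= rcons_path => /andP[].
  have cE : Some (inl x) :: s = map (Some \o inl) (x :: t) by rewrite st.
  rewrite cE has_map; apply: (@cform_guarded F) => //.
  + rewrite -(@eq_cycle _ (relpre (Some \o inl) e)); last first.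
      by move=> u v; rewrite /e /edge /= (mem_map injl).
    by move: cyc_c; rewrite cE cycle_map.
  + by move: uc; rewrite cE (map_inj_uniq injl).
- have [t st] : exists t, s = map (Some \o inr) t.
    by apply: (pathr x); move: cyc_c; rewrite /= rcons_path => /andP[].
  have cE : Some (inr x) :: s = map (Some \o inr) (x :: t) by rewrite st.
  rewrite cE has_map; apply: (@cform_guarded F') => //.
  + rewrite -(@eq_cycle _ (relpre (Some \o inr) e)); last first.
      by move=> u v; rewrite /e /edge /= (mem_map injr).
    by move: cyc_c; rewrite cE cycle_map.
  + by move: uc; rewrite cE (map_inj_uniq injr).
- have := prev_cycle cyc_c (mem_head _ _).
  by case: (prev _ _) => [[w|w]|]; rewrite /edge /=; [case/mapP..|].
Qed.

Definition binary (F F' : cform) : cform := CForm (@binary_guarded F F').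
End Binary.

Definition fbot : cform := @leaf LBot erefl.
Definition ftop : cform := @leaf LTop erefl.
Definition fvar (p : nat) : cform := @leaf (LVar p) erefl.
Definition fneg : cform -> cform := @unary LNeg erefl.
Definition fbox : cform -> cform := @unary LBox erefl.
Definition fconj : cform -> cform -> cform := @binary LAnd erefl.
Definition fdisj : cform -> cform -> cform := @binary LOr erefl.
Definition fimp : cform -> cform -> cform := @binary LImp erefl.
Definition fiff (F G : cform) : cform := fconj (fimp F G) (fimp G F).

Declare Scope cform_scope.
Delimit Scope cform_scope with F.
Bind Scope cform_scope with cform.
Notation "F ~> G" := (fimp F G)
  (at level 60, right associativity) : cform_scope.
Notation "F <~> G" := (fiff F G) (at level 65) : cform_scope.

Section Digamma.
Variable p : nat.

Section Graph.
Variable G : graph.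

(* The quotient identifying the root with all [p]-labelled vertices, with the
   class of the root represented by the root, hence carrying its label. *)
Definition kept (v : vert G) : bool := (v == groot G) || (lab v != LVar p).

Lemma kept_root : kept (groot G). Proof. by rewrite /kept eqxx. Qed.

Definition droot : {v : vert G | kept v} := exist _ (groot G) kept_root.
Definition dproj (v : vert G) : {v : vert G | kept v} := insubd droot v.
Definition dsucc (v : {v : vert G | kept v}) := map dproj (succ (val v)).
Definition dlab (v : {v : vert G | kept v}) : label := lab (val v).

Lemma dproj_val v : dproj (val v) = v.
Proof. by rewrite /dproj valKd. Qed.

Lemma dproj_edge x y :
  y \in succ x -> dproj y \in dsucc (dproj x).
Proof.
move=> xy; have kx : kept x.
  rewrite /kept; apply/orP; right; apply/eqP => lx.
  by have := size_succ x; rewrite lx /=; case: (succ x) xy.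
by rewrite /dsucc /dproj insubdK //; apply: map_f.
Qed.

Lemma digamma_size v : size (dsucc v) = arity (dlab v).
Proof. by rewrite size_map size_succ. Qed.

Lemma digamma_reach v : connect (fun x y => y \in dsucc x) droot v.
Proof.
rewrite -[v]dproj_val -[droot]dproj_val [val droot]/=.
have /connectP[s ps ->] := reach_root (val v).
elim: s (groot G) ps => [|y s IHs] x /=; first by move=> _; apply: connect0.
case/andP=> xy /IHs; apply: connect_trans; apply: connect1.
exact: dproj_edge.
Qed.

Definition digamma_graph : graph := Graph digamma_size digamma_reach.
End Graph.

Lemma digamma_guarded (F : cform) : modalised p F -> guarded (digamma_graph F).
Proof.
move=> mF c c0 cyc_c uc.
pose e := edge (digamma_graph F).
have edgeP x y : e x y -> exists2 w, w \in succ (val x) & y = dproj w.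
  by case/mapP=> w wS ->; exists w.
have edge_val x y : e x y -> y != droot F -> edge F (val x) (val y).
  case/edgeP=> w wS -> wr; have [kw|kw] := boolP (kept w).
    by rewrite /dproj insubdK.
  by case/eqP: wr; rewrite /dproj /insubd insubN.
have path_val x s : path e x s -> droot F \notin s ->
    path (edge F) (val x) (map val s).
  elim: s x => [|y s IHs] x //= /andP[xy ps].
  rewrite inE negb_or eq_sym => /andP[yr rs].
  by rewrite edge_val // IHs.
have [rc|rc] := boolP (droot F \in c); last first.
  have: has (@is_box F) (map val c); last by rewrite has_map.
  apply: (@cform_guarded F); last by rewrite map_inj_uniq //; apply: val_inj.
    by case: c c0 {cyc_c uc rc}.
  case: c cyc_c rc {c0 uc} => //= x s pc rc.
  have := path_val _ _ pc; rewrite map_rcons; apply.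
  by rewrite mem_rcons.
have [i s cE] := rot_to rc.
rewrite -(has_rot i) cE.
have us : uniq (droot F :: s) by rewrite -cE rot_uniq.
have: cycle e (droot F :: s) by rewrite -cE rot_cycle.
rewrite /= rcons_path => /andP[ps /edgeP[w wS wr]].
have rs : droot F \notin s by case/andP: us.
have pvs := path_val _ _ ps rs.
have ew : edge F (last (groot F) (map val s)) w by rewrite (last_map val s (droot F)).
have: has (@is_box F) (map val (droot F :: s)); last by rewrite has_map.
have [wroot|wroot] := eqVneq w (groot F).
  rewrite wroot in ew; apply: (@cform_guarded F) => //.
    by rewrite [cycle _ _]/= rcons_path pvs.
  by rewrite map_inj_uniq //; apply: val_inj.
have lw : lab w = LVar p.
  apply/eqP; apply: contraT => lw.
  have kw : kept w by rewrite /kept lw orbT.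
  have := congr1 val wr; rewrite /dproj insubdK //= => Ew.
  by rewrite -Ew eqxx in wroot.
have := mF (rcons (map val s) w).
rewrite rcons_path pvs last_rcons => /(_ ew lw).
by rewrite -rcons_cons has_rcons {1}/is_box lw.
Qed.

Definition digamma (F : cform) (mF : modalised p F) : cform :=
  CForm (digamma_guarded mF).
End Digamma.

Lemma modalised_box (p : nat) (F : cform) : modalised p (fbox F).
Proof. by move=> s _ _. Qed.
Arguments modalised_box : clear implicits.

Definition boxdot (p : nat) (F : cform) : cform :=
  digamma (modalised_box p (fconj F (fvar p))).

Inductive pform : Type :=
  | PBot | PTop | PVar of nat
  | PNeg of pform
  | PAnd of pform & pform
  | POr of pform & pform
  | PImp of pform & pform.

Fixpoint peval (e : nat -> bool) (t : pform) : bool :=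
  match t with
  | PBot => false
  | PTop => true
  | PVar p => e p
  | PNeg a => ~~ peval e a
  | PAnd a b => peval e a && peval e b
  | POr a b => peval e a || peval e b
  | PImp a b => peval e a ==> peval e b
  end.

Definition tautology (t : pform) : Prop := forall e, peval e t.

Fixpoint psubst (sigma : nat -> cform) (t : pform) : cform :=
  match t with
  | PBot => fbot
  | PTop => ftop
  | PVar p => sigma p
  | PNeg a => fneg (psubst sigma a)
  | PAnd a b => fconj (psubst sigma a) (psubst sigma b)
  | POr a b => fdisj (psubst sigma a) (psubst sigma b)
  | PImp a b => fimp (psubst sigma a) (psubst sigma b)
  end.

Inductive CHL : cform -> Prop :=
  | CHL_taut t sigma : tautology t -> CHL (psubst sigma t)
  | CHL_K F G : CHL (fbox (F ~> G) ~> fbox F ~> fbox G)%F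
  | CHL_bisim (F G : cform) : bisimilar F G -> CHL (F <~> G)%F
  | CHL_mp F G : CHL (F ~> G)%F -> CHL F -> CHL G
  | CHL_nec F : CHL F -> CHL (fbox F)
  | CHL_loeb F : CHL (fbox F ~> F)%F -> CHL F.

(* Main.v *)
Require Import Defs.
From mathcomp Require Import all_boot.

(** A cyclic formula [boxdot p F] unfolds, up to bisimilarity, to
    [fbox (F /\ boxdot p F)], so CHL proves the two equivalent.  Each of the four
    laws is then obtained from Löb's rule: the claim [H ~> boxdot p F] follows as
    soon as [H] yields [fbox X] for some [X] which, together with the claim
    itself, yields [F /\ boxdot p F]. *)

(** Read as the relation [a = f b], a map respecting roots, labels and successor lists is a
    bisimulation. *)
Lemma functional_bisimilar (G H : graph) (f : vert H -> vert G) :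
  f (groot H) = groot G -> (forall v, lab (f v) = lab v) ->
  (forall v, succ (f v) = map f (succ v)) -> bisimilar G H.
Proof.
move=> f_root f_lab f_succ; exists (fun a b => a = f b); last by rewrite f_root.
move=> _ v ->; split=> // i; rewrite f_lab -size_succ => iv.
by rewrite f_succ (nth_map (groot H)).
Qed.

Lemma boxdot_unfold (p : nat) (F : cform) :
  fresh p F -> bisimilar (boxdot p F) (fbox (fconj F (boxdot p F))).
Proof.
move=> pF; pose B := fbox (fconj F (fvar p)).
(* [f] folds the unfolded outer layer back onto the loop and is the identity on the inner copy of
   [boxdot p F]. *)
pose f (v : vert (fbox (fconj F (boxdot p F)))) : vert (boxdot p F) :=
  match v with
  | None => droot p B
  | Some None => dproj p (G := B) (Some None)
  | Some (Some (inl w)) => dproj p (G := B) (Some (Some (inl w)))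
  | Some (Some (inr c)) => c
  end.
(* By freshness, no vertex of [F] is merged with the root. *)
have keptF w : kept p (G := B) (Some (Some (inl w))).
  by apply/orP; right; apply/eqP; apply: pF.
have kept_conj : kept p (G := B) (Some None) by [].
have val_dproj (v : vert B) : kept p v -> val (dproj p v) = v.
  by move=> kv; rewrite /dproj insubdK.
apply: (@functional_bisimilar _ _ f) => //.
  by case=> [[[w|c]|]|] //=; rewrite /dlab val_dproj.
case=> [[[w|c]|]|] //=; rewrite /dsucc ?val_dproj //=.
- by rewrite -!map_comp.
- by rewrite -[RHS](map_comp f) -[RHS]map_comp; apply: esym; apply: map_id_in.
(* The right conjunct is the [p]-leaf, which is not kept, so [insubd] returns its default, the root:
   this is the back edge of the loop. *)
- congr [:: _; _]; apply: val_inj.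
  by rewrite /dproj /insubd insubN //= /kept /= eqxx.
Qed.

Lemma CHL_imp_trans (F G H : cform) :
  CHL (F ~> G)%F -> CHL (G ~> H)%F -> CHL (F ~> H)%F.
Proof.
move=> FG; apply: CHL_mp; move: FG; apply: CHL_mp.
apply: (@CHL_taut
  (PImp (PImp (PVar 0) (PVar 1))
     (PImp (PImp (PVar 1) (PVar 2)) (PImp (PVar 0) (PVar 2))))
  (nth fbot [:: F; G; H])).
by move=> e /=; case: (e 0); case: (e 1); case: (e 2).
Qed.

Lemma CHL_imp_conj (F G H : cform) :
  CHL (F ~> G)%F -> CHL (F ~> H)%F -> CHL (F ~> fconj G H)%F.
Proof.
move=> FG; apply: CHL_mp; move: FG; apply: CHL_mp.
apply: (@CHL_taut
  (PImp (PImp (PVar 0) (PVar 1))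
     (PImp (PImp (PVar 0) (PVar 2)) (PImp (PVar 0) (PAnd (PVar 1) (PVar 2)))))
  (nth fbot [:: F; G; H])).
by move=> e /=; case: (e 0); case: (e 1); case: (e 2).
Qed.

Lemma CHL_conjl (F G : cform) : CHL (fconj F G ~> F)%F.
Proof.
apply: (@CHL_taut (PImp (PAnd (PVar 0) (PVar 1)) (PVar 0)) (nth fbot [:: F; G])).
by move=> e /=; case: (e 0); case: (e 1).
Qed.

Lemma CHL_conjr (F G : cform) : CHL (fconj F G ~> G)%F.
Proof.
apply: (@CHL_taut (PImp (PAnd (PVar 0) (PVar 1)) (PVar 1)) (nth fbot [:: F; G])).
by move=> e /=; case: (e 0); case: (e 1).
Qed.

Lemma CHL_curry (F G H : cform) :
  CHL (fconj F G ~> H)%F -> CHL (F ~> G ~> H)%F.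
Proof.
apply: CHL_mp.
apply: (@CHL_taut
  (PImp (PImp (PAnd (PVar 0) (PVar 1)) (PVar 2))
     (PImp (PVar 0) (PImp (PVar 1) (PVar 2))))
  (nth fbot [:: F; G; H])).
by move=> e /=; case: (e 0); case: (e 1); case: (e 2).
Qed.

Lemma CHL_uncurry (F G H : cform) :
  CHL (F ~> G ~> H)%F -> CHL (fconj F G ~> H)%F.
Proof.
apply: CHL_mp.
apply: (@CHL_taut
  (PImp (PImp (PVar 0) (PImp (PVar 1) (PVar 2)))
     (PImp (PAnd (PVar 0) (PVar 1)) (PVar 2)))
  (nth fbot [:: F; G; H])).
by move=> e /=; case: (e 0); case: (e 1); case: (e 2).
Qed.

Lemma CHL_box_mono (F G : cform) : CHL (F ~> G)%F -> CHL (fbox F ~> fbox G)%F.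
Proof. by move/CHL_nec; apply: CHL_mp; apply: CHL_K. Qed.

Lemma CHL_box_conj (F G : cform) :
  CHL (fconj (fbox F) (fbox G) ~> fbox (fconj F G))%F.
Proof.
apply/CHL_uncurry/(CHL_imp_trans _ _ _ _ (CHL_K _ _))/CHL_box_mono/CHL_curry.
exact: CHL_imp_conj (CHL_conjl _ _) (CHL_conjr _ _).
Qed.

Lemma CHL_boxdot_unfold (p : nat) (F : cform) :
  fresh p F -> CHL (boxdot p F ~> fbox (fconj F (boxdot p F)))%F.
Proof.
by move/boxdot_unfold/CHL_bisim; apply: CHL_mp; apply: CHL_conjl.
Qed.

Lemma CHL_boxdot_fold (p : nat) (F : cform) :
  fresh p F -> CHL (fbox (fconj F (boxdot p F)) ~> boxdot p F)%F.
Proof.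
by move/boxdot_unfold/CHL_bisim; apply: CHL_mp; apply: CHL_conjr.
Qed.

(** Löb's rule supplies the claim under a box and [H] supplies [fbox X]. The two boxes merge, the
    last premise is applied under the box, and folding gives [boxdot p F]. *)
Lemma CHL_boxdot_intro (p : nat) (F H X : cform) :
  fresh p F -> CHL (H ~> fbox X)%F ->
  CHL (fconj (H ~> boxdot p F) X ~> fconj F (boxdot p F))%F ->
  CHL (H ~> boxdot p F)%F.
Proof.
move=> pF HX XF; apply/CHL_loeb/CHL_curry.
apply: CHL_imp_trans (CHL_boxdot_fold _ _ pF).
apply: CHL_imp_trans (CHL_box_mono _ _ XF).
apply: CHL_imp_trans (CHL_box_conj _ _).
apply: CHL_imp_conj; first exact: CHL_conjl.
exact: CHL_imp_trans (CHL_conjr _ _) HX.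
Qed.

(** The choice of bound variable is immaterial. This lets L3 and L4 align the variables of separate
    occurrences of the operator. *)
Lemma CHL_boxdot_rename (p q : nat) (F : cform) :
  fresh p F -> fresh q F -> CHL (boxdot p F ~> boxdot q F)%F.
Proof.
move=> pF qF; apply: CHL_boxdot_intro (CHL_boxdot_unfold _ _ pF) _ => //.
apply: (@CHL_taut
  (PImp (PAnd (PImp (PVar 0) (PVar 1)) (PAnd (PVar 2) (PVar 0)))
     (PAnd (PVar 2) (PVar 1)))
  (nth fbot [:: boxdot p F; boxdot q F; F])).
by move=> e /=; case: (e 0); case: (e 1); case: (e 2).
Qed.

Theorem theorem3p4 :
  [/\ (* L1 *)
      forall (F : cform) (p : nat),
        fresh p F -> CHL F -> CHL (boxdot p F),
      (* L2 *)
      forall (F G : cform) (p q r : nat),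
        fresh p (fimp F G) -> fresh q F -> fresh r G ->
        CHL (boxdot p (F ~> G) ~> boxdot q F ~> boxdot r G)%F,
      (* L3 *)
      forall (F : cform) (p q r : nat),
        fresh p F -> fresh q F -> fresh r (boxdot q F) ->
        CHL (boxdot p F ~> boxdot r (boxdot q F))%F
    & (* L4 *)
      forall (F : cform) (p q r : nat),
        fresh p F -> fresh q (fimp (boxdot p F) F) -> fresh r F ->
        CHL (boxdot q (boxdot p F ~> F) ~> boxdot r F)%F].
Proof.
split.
- move=> F p pF CF; set D := boxdot p F.
  (* As [F] is a theorem, [D] implies [fconj F D]; boxing this and folding gives [fbox D ~> D]. *)
  apply: (@CHL_loeb D); apply: CHL_imp_trans (CHL_boxdot_fold _ _ pF).
  apply: CHL_box_mono; apply: CHL_mp CF.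
  apply: (@CHL_taut (PImp (PVar 0) (PImp (PVar 1) (PAnd (PVar 0) (PVar 1))))
    (nth fbot [:: F; D])).
  by move=> e /=; case: (e 0); case: (e 1).
- move=> F G p q r pFG qF rG; set A := boxdot p _; set C := boxdot q F.
  apply: CHL_curry.
  (* [X] collects the bodies of both unfoldings: [F ~> G] and [F] yield [G], while [A] and [C]
     trigger the claim. *)
  apply: (CHL_boxdot_intro _ _ _ (fconj (fconj (F ~> G)%F A) (fconj F C))) => //.
    apply: CHL_imp_trans (CHL_box_conj _ _).
    apply: CHL_imp_conj; [apply: CHL_imp_trans (CHL_conjl _ _) _ |
                          apply: CHL_imp_trans (CHL_conjr _ _) _];
      exact: CHL_boxdot_unfold.
  apply: (@CHL_taut
    (PImp (PAnd (PImp (PAnd (PVar 0) (PVar 1)) (PVar 2))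
                (PAnd (PAnd (PImp (PVar 3) (PVar 4)) (PVar 0))
                      (PAnd (PVar 3) (PVar 1))))
       (PAnd (PVar 4) (PVar 2)))
    (nth fbot [:: A; C; boxdot r G; F; G])).
  by move=> e /=; case: (e 0); case: (e 1); case: (e 2); case: (e 3); case: (e 4).
- move=> F p q r pF qF rB; set C := boxdot q F.
  apply: CHL_imp_trans (CHL_boxdot_rename _ _ _ pF qF) _.
  (* Unfolding [C] puts [C] itself under the box; it is the first conjunct needed, and the claim
     turns it into the second. *)
  apply: CHL_boxdot_intro (CHL_boxdot_unfold _ _ qF) _ => //.
  apply: (@CHL_taut
    (PImp (PAnd (PImp (PVar 0) (PVar 1)) (PAnd (PVar 2) (PVar 0)))
       (PAnd (PVar 0) (PVar 1)))
    (nth fbot [:: C; boxdot r C; F])).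
  by move=> e /=; case: (e 0); case: (e 1); case: (e 2).
- move=> F p q r pF qH rF; set C := boxdot p F; set A := boxdot q _.
  (* Here [X] consists of [C ~> F] and [A]: the claim turns [A] into [C], from which [F] is
     detached. This requires the variable [p] of the antecedent; renaming to [r] comes
     afterwards. *)
  have AC : CHL (A ~> C)%F.
    apply: CHL_boxdot_intro (CHL_boxdot_unfold _ _ qH) _ => //.
    apply: (@CHL_taut
      (PImp (PAnd (PImp (PVar 0) (PVar 1)) (PAnd (PImp (PVar 1) (PVar 2)) (PVar 0)))
         (PAnd (PVar 2) (PVar 1)))
      (nth fbot [:: A; C; F])).
    by move=> e /=; case: (e 0); case: (e 1); case: (e 2).
  exact: CHL_imp_trans AC (CHL_boxdot_rename _ _ _ pF rF).
Qed.
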